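(* Let $z$ be an indeterminate, let $A(n,k)=\sum_{j=0}^{k}(-1)^j(k-j)^n\binom{n+1}{j}$ (the Eulerian numbers, with $0^0=1$), and let $\mathsf{EU}_n(z)=\sum_{k=0}^nA(n,k)z^k$ be the Eulerian polynomials. Let $\mathbf{L}$ be the exponential Riordan array $$\left[\frac{e^{zx}(1-z)}{e^{zx}-ze^x},\ \frac{e^{x}-e^{zx}}{e^{zx}-ze^x}\right]$$ (which in the case $z=1$ is taken to be $\left[\frac{1}{1-x},\frac{x}{1-x}\right]$). Then $\mathbf{L}^{-1}$ is the coefficient array of a family of (monic) orthogonal polynomials, and the polynomials $\mathsf{EU}_n(z)$, $n\ge0$, are the moments of this family.
   Context: For a power series $g(x)=g_0+g_1x+\cdots$ and a power series $f(x)=f_1x+f_2x^2+\cdots$ with $f_1\neq 0$, the exponential Riordan array $[g,f]$ is the infinite lower-triangular matrix (rows and columns indexed from $0$) whose $k$-th column has exponential generating function $g(x)f(x)^k/k!$, i.e. its $(n,k)$ entry is $\frac{n!}{k!}[x^n]\,g(x)f(x)^k$. Multiplication is $[g,f]\cdot[h,l]=[g\,(h\circ f),\,l\circ f]$ and $[g,f]^{-1}=[1/(g\circ\bar f),\bar f]$ where $\bar f$ is the compositional inverse of $f$. A lower-triangular matrix $M=(m_{n,k})$ is the coefficient array of the polynomial family $p_n(x)=\sum_k m_{n,k}x^k$. A family of monic polynomials $(p_n)$ is called a family of orthogonal polynomials if it satisfies a three-term recurrence $p_{n+1}(x)=(x-\alpha_n)p_n(x)-\beta_np_{n-1}(x)$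 for $n\ge1$, with $p_0=1$, $p_1=x-\alpha_0$, and all $\beta_n\neq0$. The moments of such a family are the entries of the first column (column $0$) of the inverse of its coefficient array. *)

(* Defs.v *)
From mathcomp Require Import all_boot all_order all_algebra.
From mathcomp Require Import fraction.

Set Implicit Arguments.
Unset Strict Implicit.
Unset Printing Implicit Defensive.

Import GRing.Theory.
Local Open Scope ring_scope.

Section PowerSeries.
Variable K : fieldType.

(* A formal power series sum_n (a n) x^n is its coefficient sequence. *)
Definition fps := nat -> K.

Implicit Types (a b f g : fps) (z : K).

Definition fps_one : fps := fun n => (n == 0%N)%:R.

Definition fps_X : fps := fun n => (n == 1%N)%:R.

Definition fps_mul a b : fps := fun n => \sum_(i < n.+1) a i * b (n - i)%N.

Definition fps_pow a k : fps := iter k (fps_mul a) fps_one.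

(* The list of the coefficients 0, ..., n of 1/b, by the usual recurrence
   c_0 = 1/b_0,  c_n = - (1/b_0) sum_(i < n) c_i b_(n-i). *)
Fixpoint fps_inv_table b n : seq K :=
  if n is m.+1 then
    let s := fps_inv_table b m in
    rcons s (- ((b 0%N)^-1 * \sum_(i < n) s`_i * b (n - i)%N))
  else [:: (b 0%N)^-1].

Definition fps_inv b : fps := fun n => (fps_inv_table b n)`_n.

Definition fps_div a b : fps := fps_mul a (fps_inv b).

(* e^(z x) *)
Definition fps_exp z : fps := fun n => z ^+ n / (n`!)%:R.

Lemma size_fps_inv_table b n : size (fps_inv_table b n) = n.+1.
Proof. by elim: n => //= n IHn; rewrite size_rcons IHn. Qed.

Lemma nth_fps_inv_table b n i :
  (i <= n)%N -> (fps_inv_table b n)`_i = fps_inv b i.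
Proof.
elim: n => [|n IHn]; first by rewrite leqn0 => /eqP->.
rewrite leq_eqVlt => /orP[/eqP-> // | lt_in].
by rewrite /= nth_rcons size_fps_inv_table lt_in IHn.
Qed.

Lemma fps_invS b n :
  fps_inv b n.+1 =
  - ((b 0%N)^-1 * \sum_(i < n.+1) fps_inv b i * b (n.+1 - i)%N).
Proof.
rewrite {1}/fps_inv /= nth_rcons size_fps_inv_table ltnn eqxx.
congr (- (_ * _)); apply: eq_bigr => i _.
by rewrite nth_fps_inv_table // -ltnS.
Qed.

Lemma fps_mulVf b : b 0%N != 0 -> fps_mul (fps_inv b) b =1 fps_one.
Proof.
move=> b0 [|n]; rewrite /fps_mul /fps_one.
  by rewrite big_ord_recl big_ord0 addr0 subnn /fps_inv /= mulVf.
by rewrite big_ord_recr /= subnn fps_invS mulNr mulrAC mulVf // mul1r subrr.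
Qed.

End PowerSeries.

Section Arrays.
Variable K : fieldType.

(* Infinite matrices, with rows and columns indexed from 0. *)
Definition array := nat -> nat -> K.

Implicit Types (A B M : array) (g f : fps K) (p : nat -> {poly K}).

Definition lower_triangular A := forall n k, (n < k)%N -> A n k = 0.

(* The product of infinite matrices when the left factor is lower triangular,
   which makes the terms with j > n vanish. *)
Definition array_mul A B : array := fun n k => \sum_(j < n.+1) A n j * B j k.

Definition array_one : array := fun n k => (n == k)%:R.

Definition is_inverse A B :=
  [/\ lower_triangular A, lower_triangular B,
      array_mul A B =2 array_one & array_mul B A =2 array_one].

Lemma is_inverse_sym A B : is_inverse A B -> is_inverse B A.
Proof. by case. Qed.

Lemma is_inverse_unique A B C : is_inverse A B -> is_inverse A C -> B =2 C.
Proof.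
move=> [ltA ltB _ BA] [_ _ AC _] n k.
have -> : B n k = \sum_(j < n.+1) \sum_(i < n.+1) B n j * (A j i * C i k).
  transitivity (\sum_(j < n.+1) B n j * array_one j k).
    case: (ltnP n k) => [lt_nk | le_kn].
      rewrite ltB // big1 // => j _; rewrite /array_one ltn_eqF ?mulr0 //.
      exact: leq_ltn_trans (leq_ord j) lt_nk.
    have lt_kn : (k < n.+1)%N by [].
    rewrite (bigD1 (Ordinal lt_kn)) //= /array_one eqxx mulr1 big1 ?addr0 //.
    move=> j; rewrite -val_eqE /= => /negPf->; exact: mulr0.
  apply: eq_bigr => j _; rewrite -AC -mulr_sumr; congr (_ * _).
  rewrite /array_mul (big_ord_widen n.+1 (fun i => A j i * C i k)) //.
  rewrite big_mkcond; apply: eq_bigr => i _.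
  by case: ifPn => //; rewrite -leqNgt => lt_ji; rewrite ltA ?mul0r.
rewrite exchange_big /=.
transitivity (\sum_(i < n.+1) array_one n i * C i k).
  apply: eq_bigr => i _; rewrite -BA /array_mul mulr_suml.
  by apply: eq_bigr => j _; rewrite mulrA.
rewrite (bigD1 ord_max) //= /array_one eqxx mul1r big1 ?addr0 // => i.
by rewrite -val_eqE /= eq_sym => /negPf->; rewrite mul0r.
Qed.

Definition exp_riordan g f : array :=
  fun n k => (n`!)%:R / (k`!)%:R * fps_mul g (fps_pow f k) n.

Definition row_poly M (n : nat) : {poly K} := \poly_(k < n.+1) M n k.

Definition monic_orthogonal p :=
  (forall n, p n \is monic) /\
  exists alpha beta : nat -> K,
    [/\ p 0%N = 1,
        p 1%N = 'X - (alpha 0%N)%:P,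
        forall n, (1 <= n)%N ->
          p n.+1 = ('X - (alpha n)%:P) * p n - beta n *: p n.-1
      & forall n, (1 <= n)%N -> beta n != 0].

(* The inverse is unique by is_inverse_unique. *)
Definition is_moments M (mu : nat -> K) :=
  exists2 N, is_inverse M N & forall n, mu n = N n 0%N.

End Arrays.

(* Here 0 ^ 0 = 1, so eulerian 0 0 = 1. *)
Definition eulerian (n k : nat) : int :=
  \sum_(j < k.+1) (-1) ^+ j * ((k - j) ^ n * 'C(n.+1, j))%N%:Z.

Definition EU (n : nat) : {poly int} := \poly_(k < n.+1) eulerian n k.

Section EulerianArray.
Variables (K : fieldType) (z : K).

(* e^(z x) - z e^x; its constant term is 1 - z. *)
Definition L_den : fps K := fun n => fps_exp z n - z * fps_exp 1 n.

Definition L_g : fps K :=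
  if z == 1 then fps_div (@fps_one K) (fun n => fps_one K n - fps_X K n)
  else fps_div (fun n => fps_exp z n * (1 - z)) L_den.

Definition L_f : fps K :=
  if z == 1 then fps_div (@fps_X K) (fun n => fps_one K n - fps_X K n)
  else fps_div (fun n => fps_exp 1 n - fps_exp z n) L_den.

Definition L_array : array K := exp_riordan L_g L_f.

Definition EU_at (n : nat) : K := (map_poly intr (EU n)).[z].

Definition EU_are_moments :=
  exists P : array K,
    [/\ is_inverse L_array P,
        monic_orthogonal (row_poly P)
      & is_moments P EU_at].

End EulerianArray.

(* Main.v *)
(* Put f = L_f, g = L_g.  Both for z = 1 and for z <> 1 one has g = 1 + z f and
   f' = (1 + f)(1 + z f).  Hence the columns c_k = g f^k / k! satisfy
     c_k' = c_(k-1) + (z + (1 + z) k) c_k + z (k + 1)^2 c_(k+1),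
   a tridiagonal recurrence for the entries of L, which says exactly that the
   rows of the inverse are the monic orthogonal polynomials with
   alpha_k = z + (1 + z) k and beta_k = z k^2.
   The first column of L is identified with EU_n(z) through
     EU_(n+1) = z sum_(i <= n) C(n+1, i) (1 - z)^(n-i) EU_i,
   itself a consequence of EU_n(z) = (1 - z)^(n+1) sum_k k^n z^k. *)
Require Import Defs.
From mathcomp Require Import all_boot all_order all_algebra.
From mathcomp Require Import fraction.
From Stdlib Require Import Setoid Morphisms Ring.
Import GRing.Theory.
Set Implicit Arguments.
Local Open Scope ring_scope.

(** * One-sided inverses of lower triangular arrays *)

Lemma lower_triangular_inverseC (K : fieldType) (A B : array K) :
  lower_triangular A -> lower_triangular B ->
  array_mul A B =2 @array_one K -> array_mul B A =2 @array_one K.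
Proof.
move=> ltA ltB AB n k; pose N := (maxn n k).+1.
pose mx (M : array K) := \matrix_(i < N, j < N) M i j.
(* Cutting to the leading [N] by [N] block commutes with products whose left factor is lower
   triangular, so the claim reduces to finite square matrices, where a right inverse is a left
   inverse. *)
have mxM (M M' : array K) : lower_triangular M ->
    mx M *m mx M' = mx (array_mul M M').
  move=> ltM; apply/matrixP=> i j; rewrite !mxE /array_mul.
  rewrite (big_ord_widen N (fun l => M i l * M' l j)) // [RHS]big_mkcond.
  apply: eq_bigr => l _; rewrite !mxE; case: ifPn => //.
  by rewrite -leqNgt => ltil; rewrite ltM ?mul0r.
have mx1 : mx (@array_one K) = 1%:M.
  by apply/matrixP=> i j; rewrite !mxE.
have /mulmx1C : mx A *m mx B = 1%:M.
  by rewrite mxM // -mx1; apply/matrixP=> i j; rewrite !mxE.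
rewrite mxM // => /matrixP BA.
have ltn : (n < N)%N by rewrite ltnS leq_maxl.
have ltk : (k < N)%N by rewrite ltnS leq_maxr.
by have := BA (Ordinal ltn) (Ordinal ltk); rewrite !mxE.
Qed.

(** * From a tridiagonal recurrence to orthogonal polynomials *)

Section Tridiagonal.
Variable K : fieldType.
Variables (alpha beta : nat -> K) (L : array K).

Fixpoint monic_op n : {poly K} :=
  if n is m.+1 then
    ('X - (alpha m)%:P) * monic_op m
      - (if m is l.+1 then beta m *: monic_op l else 0)
  else 1.

Lemma monic_op_size n : monic_op n \is monic /\ size (monic_op n) = n.+1.
Proof.
(* The recurrence reaches back two indices, so the induction runs on a strict upper bound of [n]. *)
have [m ltnm] : exists m, (n < m)%N by exists n.+1.
elim: m n ltnm => // m IHm [|n] ltnm; first by rewrite monic1 size_poly1.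
have [mn sn] := IHm n ltnm.
have sX : size (('X - (alpha n)%:P) * monic_op n) = n.+2.
  by rewrite size_monicM ?monicXsubC ?monic_neq0 // size_XsubC sn.
have lt_s : (size (- (if n is l.+1 then beta n *: monic_op l else 0))
    < size (('X - (alpha n)%:P) * monic_op n)%R)%N.
  rewrite sX size_polyN; case: n ltnm {mn sn sX} => [|l] ltlm.
    by rewrite size_poly0.
  have [_ sl] := IHm l (ltnW ltlm).
  by rewrite ltnS (leq_trans (size_scale_leq _ _)) // sl.
rewrite /= size_polyDl // sX; split=> //.
by rewrite monicE lead_coefDl // -monicE monicMl ?monicXsubC.
Qed.

Definition monic_op_array : array K := fun n k => (monic_op n)`_k.

Lemma row_poly_monic_op n : row_poly monic_op_array n = monic_op n.
Proof.
have [_ sn] := monic_op_size n; apply/polyP=> k; rewrite coef_poly ltnS.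
case: leqP => // ltnk; by rewrite nth_default ?sn.
Qed.

Hypothesis beta_neq0 : forall n, (1 <= n)%N -> beta n != 0.
Hypothesis L0 : forall k, L 0%N k = (k == 0%N)%:R.
Hypothesis LS0 :
  forall n, L n.+1 0%N = alpha 0%N * L n 0%N + beta 1%N * L n 1%N.
Hypothesis LSS : forall n k,
  L n.+1 k.+1 = L n k + alpha k.+1 * L n k.+1 + beta k.+2 * L n k.+2.

Lemma tridiagonal_lower : lower_triangular L.
Proof.
elim=> [|n IHn] [|k] //; rewrite ?L0 // ltnS => ltnk.
by rewrite LSS !IHn ?mulr0 ?addr0 // 1?ltnS ltnW // ltnS ltnW.
Qed.

(** Multiply by ['X] and use X p_k = p_(k+1) + alpha_k p_k + beta_k p_(k-1): the new coefficient of
    p_k is L(n,k-1) + alpha_k L(n,k) + beta_(k+1) L(n,k+1), which the hypotheses equate with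
    L(n+1,k). *)
Lemma tridiagonal_sum n : \sum_(k < n.+1) L n k *: monic_op k = 'X^n.
Proof.
elim: n => [|n IHn]; first by rewrite big_ord1 L0 scale1r.
pose c k := alpha k *: monic_op k + (if k is l.+1 then beta k *: monic_op l
  else 0).
have step k : 'X * monic_op k = monic_op k.+1 + c k.
  by rewrite /c /= mulrBl mul_polyC addrA addrAC addrNK addrNK.
have lt0 k : (n < k)%N -> L n k = 0 by apply: tridiagonal_lower.
rewrite exprS -IHn mulr_sumr.
under [RHS]eq_bigr => k _ do rewrite -scalerAr step scalerDr.
rewrite big_split /=.
have -> : \sum_(k < n.+1) L n k *: c k = \sum_(k < n.+2) (L n k * alpha k) *:
  monic_op k
    + \sum_(k < n.+2) (L n k.+1 * beta k.+1) *: monic_op k.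
  (* The added terms vanish because [L n k] is zero for k > n; they leave room for the index shift
     in the [beta] sum. *)
  transitivity (\sum_(k < n.+3) L n k *: c k).
    by rewrite [RHS]big_ord_recr [in RHS]big_ord_recr /= !lt0 ?scale0r ?addr0.
  rewrite /c; under eq_bigr => k _ do rewrite scalerDr !scalerA.
  rewrite big_split /=; congr (_ + _).
    by rewrite big_ord_recr /= lt0 ?mul0r ?scale0r ?addr0.
  rewrite big_ord_recl /= scaler0 add0r; apply: eq_bigr => k _.
  by rewrite scalerA.
rewrite big_ord_recl [in RHS](addrC (\sum_(k < n.+1) _)) -big_split /=.
rewrite [in RHS]big_ord_recl -scalerDl -addrA; congr (_ + _).
  by rewrite LS0 mulrC [beta _ * _]mulrC.
rewrite -big_split; apply: eq_bigr => k _ /=.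
by rewrite -!scalerDl LSS -addrA addrC (mulrC (L n k.+1)) (mulrC (L n k.+2)).
Qed.

Theorem tridiagonal_orthogonal :
  exists P : array K, is_inverse L P /\ monic_orthogonal (row_poly P).
Proof.
have ltP : lower_triangular monic_op_array.
  by move=> n k ltnk; rewrite /monic_op_array nth_default // (monic_op_size
    n).2.
(* This is [tridiagonal_sum] read at the coefficient of ['X^k]. *)
have LP : array_mul L monic_op_array =2 @array_one K.
  move=> n k; rewrite /array_one eq_sym -coefXn -tridiagonal_sum coef_sum.
  by apply: eq_bigr => j _; rewrite coefZ.
exists monic_op_array; split.
  split=> //; first exact: tridiagonal_lower.
  exact: lower_triangular_inverseC tridiagonal_lower ltP LP.
split=> [n|]; first by rewrite row_poly_monic_op; case: (monic_op_size n).
exists alpha, beta; split=> //; rewrite ?row_poly_monic_op //=.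
  by rewrite subr0 mulr1.
by case=> // n _; rewrite !row_poly_monic_op.
Qed.

End Tridiagonal.

(** * The recurrence for the Eulerian polynomials *)

Section EulerianRecurrence.
Variable K : fieldType.

Definition EUK n : {poly K} := map_poly intr (EU n).
(** Truncation of the series sum_k k^n x^k, with 0^0 = 1 when n = 0. *)
Definition power_sum_poly N n : {poly K} := \poly_(k < N) (k ^ n)%:R.

Lemma coef_EUK n k : (EUK n)`_k = if (k <= n)%N then (eulerian n k)%:~R else 0.
Proof. by rewrite coef_map_id0 // coef_poly ltnS; case: ifP. Qed.

Lemma coef_one_subX_exp n j : ((1 - 'X : {poly K}) ^+ n)`_j = (-1) ^+ j *+
  'C(n, j).
Proof.
rewrite exprBn coef_sum; under eq_bigr => i _.
  rewrite expr1n mulr1 coefMn -polyC1 -polyCN -polyC_exp mul_polyC coefZ coefXn.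
  over.
case: (ltnP n j) => [ltnj | lejn].
  rewrite bin_small // mulr0n big1 // => i _.
  by rewrite gtn_eqF ?mulr0 ?mul0rn // (leq_ltn_trans (leq_ord i)).
have ltjn : (j < n.+1)%N by [].
rewrite (bigD1 (Ordinal ltjn)) //= eqxx mulr1 big1 ?addr0 // => i.
by rewrite -val_eqE /= eq_sym => /negPf->; rewrite mulr0 mul0rn.
Qed.

(** Convolving the coefficients (-1)^j C(n+1,j) of (1-x)^(n+1) with (k-j)^n reproduces the defining
    sum of A(n,k); for k < N the truncation is not felt. *)
Lemma coef_eulerian_series N n k : (k < N)%N ->
  ((1 - 'X) ^+ n.+1 * power_sum_poly N n)`_k = (eulerian n k)%:~R.
Proof.
move=> ltkN; rewrite coefM raddf_sum /=; apply: eq_bigr => j _.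
rewrite coef_one_subX_exp coef_poly (leq_ltn_trans (leq_subr _ _) ltkN).
by rewrite rmorphM rmorph_sign /= -pmulrn natrM -[_ ^+ j *+ _]mulr_natr mulrAC
  mulrA.
Qed.

(** Congruence modulo ['X^N]; quantified over [N], it expresses power series identities through
    polynomials. *)
Definition eqmodX N (p q : {poly K}) := forall k, (k < N)%N -> p`_k = q`_k.

Lemma eqmodX_mull N r p q : eqmodX N p q -> eqmodX N (r * p) (r * q).
Proof.
move=> pq k ltkN; rewrite !coefM; apply: eq_bigr => i _.
by rewrite pq // (leq_ltn_trans (leq_subr _ _)).
Qed.

Lemma eqmodX_subX_cancel N p q :
  eqmodX N ((1 - 'X) * p) ((1 - 'X) * q) -> eqmodX N p q.
Proof.
move=> pq; elim=> [|k IHk] ltkN; move: (pq _ ltkN); rewrite !mulrBl !mul1r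
  !coefB !coefXM /=.
  by rewrite !subr0.
by rewrite IHk ?(ltnW ltkN) // => /addIr.
Qed.

(** Binomial expansion of (1 + k)^(n+1), moved to coefficient k+1 by the factor ['X]; at coefficient
    0 both sides vanish. *)
Lemma shifted_power_sum N n :
  eqmodX N ('X * (\sum_(i < n.+2) power_sum_poly N i *+ 'C(n.+1, i)))
    (power_sum_poly N n.+1).
Proof.
move=> [|k] ltkN; rewrite coefXM coef_poly ltkN /= ?exp0n //.
rewrite -[k.+1]add1n expnDn natr_sum coef_sum; apply: eq_bigr => i _.
by rewrite coefMn coef_poly (ltnW ltkN) exp1n mul1n natrM mulr_natl.
Qed.

Definition EUK_rhs n :=
  'X * \sum_(i < n.+1) ((1 - 'X) ^+ (n - i) * EUK i) *+ 'C(n.+1, i).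

Lemma size_EUK n : (size (EUK n) <= n.+1)%N.
Proof. by apply/leq_sizeP=> k ltnk; rewrite coef_EUK leqNgt ltnk. Qed.

(** This degree bound lets the recurrence follow from agreement of the coefficients up to n+1. *)
Lemma size_EUK_rhs n : (size (EUK_rhs n) <= n.+2)%N.
Proof.
rewrite /EUK_rhs (leq_trans (size_polyMleq _ _)) // size_polyX add2n ltnS.
apply: (leq_trans (size_sum _ _ _)); apply/bigmax_leqP => i _.
rewrite -scaler_nat; apply: (leq_trans (size_scale_leq _ _)).
apply: (leq_trans (size_polyMleq _ _)).
have s1 : (size ((1 - 'X : {poly K}) ^+ (n - i)) <= (n - i).+1)%N.
  apply/leq_sizeP=> k ltk; by rewrite coef_one_subX_exp bin_small.
have := leq_add s1 (size_EUK i); rewrite addSn addnS subnK ?leq_ord //.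
by case: (_ + _)%N.
Qed.

(** Let P_i be the power sums and S the sum of C(n+1,i) P_i over i <= n. Then (1-X) times the left
    side is (1-X)^(n+2) X S, while [shifted_power_sum] gives X S = (1-X) P_(n+1); a factor 1-X is
    then cancelled. *)
Lemma EUK_rhs_series n :
  (forall i, (i <= n)%N -> forall N,
     eqmodX N (EUK i) ((1 - 'X) ^+ i.+1 * power_sum_poly N i)) ->
  forall N, eqmodX N (EUK_rhs n) ((1 - 'X) ^+ n.+2 * power_sum_poly N n.+1).
Proof.
move=> IH N; apply: eqmodX_subX_cancel => k ltkN.
pose S := \sum_(i < n.+1) power_sum_poly N i *+ 'C(n.+1, i).
transitivity (((1 - 'X) ^+ n.+2 * ('X * S))`_k).
  rewrite /EUK_rhs mulrCA [in RHS]mulrCA; apply: (@eqmodX_mull N _ _ _ _ k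
    ltkN) => j ltjN.
  rewrite !mulr_sumr !coef_sum; apply: eq_bigr => i _.
  rewrite !mulrnAr !coefMn mulrA -exprS -subSn ?leq_ord //; congr (_ *+ _).
  have -> : n.+2 = (n.+1 - i + i.+1)%N by rewrite addnS subnK // ltnW.
  rewrite exprD -mulrA; apply: (@eqmodX_mull N _ _ _ _ j ltjN); apply: IH;
    exact: leq_ord.
rewrite [in RHS]mulrCA; apply: (@eqmodX_mull N _ _ _ _ k ltkN) => j ltjN.
have := @shifted_power_sum N n j ltjN.
rewrite big_ord_recr /= binn mulr1n mulrDr coefD mulrBl mul1r coefB => <-.
by rewrite addrK.
Qed.

Lemma EUK_from_series n :
  (forall i, (i <= n)%N -> forall N,
     eqmodX N (EUK i) ((1 - 'X) ^+ i.+1 * power_sum_poly N i)) ->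
  EUK n.+1 = EUK_rhs n.
Proof.
move=> IH; apply/polyP=> k; rewrite coef_EUK; case: leqP => [lekn | ltnk].
  by rewrite (EUK_rhs_series n IH k.+1) // coef_eulerian_series.
by rewrite nth_default // (leq_trans (size_EUK_rhs n)).
Qed.

Lemma EUK0 : EUK 0 = 1.
Proof.
apply/polyP=> k; rewrite coef_EUK coef1 leqn0; case: eqP => // ->.
by rewrite /eulerian big_ord1.
Qed.

(** Given [coef_eulerian_series], the content is that A(n,k) is zero in K for k > n. In the strong
    induction, the identities up to n yield the recurrence, and the recurrence yields the identity
    at n+1; the base case is the finite geometric sum. *)
Lemma EUK_series n N : eqmodX N (EUK n) ((1 - 'X) ^+ n.+1 * power_sum_poly N n).
Proof.
elim/ltn_ind: n N => -[|n] IH N.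
  have -> : power_sum_poly N 0 = \sum_(k < N) 'X^k.
    by rewrite /power_sum_poly poly_def; apply: eq_bigr => k _; rewrite scale1r.
  have := subrX1 ('X : {poly K}) N; move/(congr1 -%R).
  rewrite -mulNr !opprB expr1 => <- k ltkN.
  by rewrite EUK0 coefB coefXn ltn_eqF ?subr0.
by rewrite EUK_from_series //; apply: EUK_rhs_series.
Qed.

Lemma EUK_rec n :
  EUK n.+1 =
  'X * \sum_(i < n.+1) ((1 - 'X) ^+ (n - i) * EUK i) *+ 'C(n.+1, i).
Proof. by apply: EUK_from_series => i _; apply: EUK_series. Qed.

Lemma EU_at0 (z : K) : EU_at z 0 = 1.
Proof. by rewrite /EU_at -/(EUK 0) EUK0 hornerC. Qed.

Lemma EU_at_rec (z : K) n :
  EU_at z n.+1 =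
  z * \sum_(i < n.+1) ((1 - z) ^+ (n - i) * EU_at z i) *+ 'C(n.+1, i).
Proof.
rewrite {1}/EU_at -/(EUK n.+1) EUK_rec hornerM hornerX horner_sum.
congr (_ * _); apply: eq_bigr => i _.
by rewrite hornerMn hornerM horner_exp !hornerE.
Qed.

End EulerianRecurrence.

(** * The differential ring of formal power series *)

Section PowerSeriesRing.
Variable K : fieldType.
Implicit Types (a b c : fps K) (z : K).

(** Series are functions, so they are compared coefficientwise as a setoid; the congruence instances
    make [rewrite] and [ring] work up to this relation. *)
Definition fps_eq (a b : fps K) : Prop := forall n, a n = b n.
Definition fps_const z : fps K := fun n => z * (n == 0%N)%:R.
Definition fps_add a b : fps K := fun n => a n + b n.
Definition fps_opp a : fps K := fun n => - a n.
Definition fps_sub a b : fps K := fps_add a (fps_opp b).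
Definition fps_deriv a : fps K := fun n => a n.+1 *+ n.+1.

Lemma fps_eq_equiv : Equivalence fps_eq.
Proof.
by split=> [a n|a b ab n|a b c ab bc n]; rewrite ?ab ?bc.
Qed.
#[local] Existing Instance fps_eq_equiv.

#[local] Instance fps_add_proper : Proper (fps_eq ==> fps_eq ==> fps_eq)
  fps_add.
Proof. by move=> a a' aa b b' bb n; rewrite /fps_add aa bb. Qed.
#[local] Instance fps_opp_proper : Proper (fps_eq ==> fps_eq) fps_opp.
Proof. by move=> a a' aa n; rewrite /fps_opp aa. Qed.
#[local] Instance fps_sub_proper : Proper (fps_eq ==> fps_eq ==> fps_eq)
  fps_sub.
Proof. by move=> a a' aa b b' bb n; rewrite /fps_sub /fps_add /fps_opp aa bb.
  Qed.
#[local] Instance fps_mul_proper :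
  Proper (fps_eq ==> fps_eq ==> fps_eq) (@fps_mul K).
Proof. by move=> a a' aa b b' bb n; apply: eq_bigr => i _; rewrite aa bb. Qed.
#[local] Instance fps_deriv_proper : Proper (fps_eq ==> fps_eq) fps_deriv.
Proof. by move=> a a' aa n; rewrite /fps_deriv aa. Qed.

(** A coefficient of a product sees only truncations of the factors, so ring laws and the Leibniz
    rule transfer from polynomials. *)
Lemma fps_mul_coefM a b N n : (n < N)%N ->
  fps_mul a b n = ((\poly_(i < N) a i) * (\poly_(i < N) b i))`_n.
Proof.
move=> ltnN; rewrite coefM; apply: eq_bigr => i _; rewrite !coef_poly.
by rewrite (leq_ltn_trans (leq_ord i) ltnN) (leq_ltn_trans (leq_subr _ _) ltnN).
Qed.

Lemma fps_mulC a b : fps_eq (fps_mul a b) (fps_mul b a).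
Proof. by move=> n; rewrite !(@fps_mul_coefM _ _ n.+1) // mulrC. Qed.

Lemma fps_mulA a b c :
  fps_eq (fps_mul a (fps_mul b c)) (fps_mul (fps_mul a b) c).
Proof.
move=> n; pose t (d : fps K) := \poly_(i < n.+1) d i.
transitivity ((t a * (t b * t c))`_n); last rewrite mulrA.
  rewrite coefM; apply: eq_bigr => i _; rewrite coef_poly ltn_ord.
  by rewrite (@fps_mul_coefM _ _ n.+1) // ltnS leq_subr.
rewrite coefM; apply: eq_bigr => i _.
by rewrite coef_poly ltnS leq_subr (@fps_mul_coefM _ _ n.+1).
Qed.

Lemma fps_mulDl a b c :
  fps_eq (fps_mul (fps_add a b) c) (fps_add (fps_mul a c) (fps_mul b c)).
Proof.
by move=> n; rewrite /fps_add /fps_mul -big_split; apply: eq_bigr => i _;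
  rewrite mulrDl.
Qed.

Lemma fps_mul_const z a n : fps_mul (fps_const z) a n = z * a n.
Proof.
rewrite /fps_mul big_ord_recl /fps_const eqxx mulr1 subn0 big1 ?addr0 // => i _.
by rewrite /= mulr0 mul0r.
Qed.

Lemma fps_one_const : fps_eq (@fps_one K) (fps_const 1).
Proof. by move=> n; rewrite /fps_const mul1r. Qed.

Lemma fps_ring_theory :
  ring_theory (fps_const 0) (@fps_one K) fps_add (@fps_mul K) fps_sub fps_opp
    fps_eq.
Proof.
split=> [a n|a b n|a b c n|a|||||].
- by rewrite /fps_add /fps_const mul0r add0r.
- by rewrite /fps_add addrC.
- by rewrite /fps_add addrA.
- by rewrite fps_one_const => n; rewrite fps_mul_const mul1r.
- exact: fps_mulC.
- exact: fps_mulA.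
- exact: fps_mulDl.
- by [].
- by move=> a n; rewrite /fps_add /fps_opp /fps_const mul0r subrr.
Qed.

Lemma fps_ring_ext : ring_eq_ext fps_add (@fps_mul K) fps_opp fps_eq.
Proof. by split; apply _. Qed.

Add Ring fps_ring : fps_ring_theory (setoid fps_eq_equiv fps_ring_ext).

Lemma fps_mul1 a : fps_eq (fps_mul (fps_one K) a) a.
Proof. ring. Qed.

Lemma fps_const_add x y :
  fps_eq (fps_const (x + y)) (fps_add (fps_const x) (fps_const y)).
Proof. by move=> n; rewrite /fps_add /fps_const mulrDl. Qed.

Lemma fps_const_mul x y :
  fps_eq (fps_const (x * y)) (fps_mul (fps_const x) (fps_const y)).
Proof. by move=> n; rewrite fps_mul_const /fps_const mulrA. Qed.

Lemma fps_const_opp x : fps_eq (fps_const (- x)) (fps_opp (fps_const x)).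
Proof. by move=> n; rewrite /fps_opp /fps_const mulNr. Qed.

Lemma fps_deriv_const z : fps_eq (fps_deriv (fps_const z)) (fps_const 0).
Proof. by move=> n; rewrite /fps_deriv /fps_const mulr0 mul0r mul0rn. Qed.

Lemma fps_deriv_one : fps_eq (fps_deriv (fps_one K)) (fps_const 0).
Proof. by rewrite fps_one_const fps_deriv_const. Qed.

Lemma fps_deriv_add a b :
  fps_eq (fps_deriv (fps_add a b)) (fps_add (fps_deriv a) (fps_deriv b)).
Proof. by move=> n; rewrite /fps_deriv /fps_add mulrnDl. Qed.

Lemma fps_deriv_opp a : fps_eq (fps_deriv (fps_opp a)) (fps_opp (fps_deriv a)).
Proof. by move=> n; rewrite /fps_deriv /fps_opp mulNrn. Qed.

Lemma fps_deriv_mul a b :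
  fps_eq (fps_deriv (fps_mul a b))
    (fps_add (fps_mul (fps_deriv a) b) (fps_mul a (fps_deriv b))).
Proof.
(* Coefficient n of a derivative reads coefficient n+1, hence the bound [n.+2]. *)
move=> n; pose t (d : fps K) := \poly_(i < n.+2) d i.
have td (d : fps K) i : (i <= n)%N -> (t d)^`()`_i = fps_deriv d i.
  by move=> le_in; rewrite coef_deriv coef_poly !ltnS le_in.
rewrite {1}/fps_deriv (@fps_mul_coefM _ _ n.+2) // -coef_deriv derivM coefD.
rewrite /fps_add /fps_mul !coefM; congr (_ + _); apply: eq_bigr => i _.
  by rewrite td ?leq_ord // coef_poly ltnS leqW ?leq_subr.
by rewrite td ?leq_subr // coef_poly ltnS leqW ?leq_ord.
Qed.

Lemma fps_powS a k : fps_pow a k.+1 = fps_mul a (fps_pow a k).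
Proof. by []. Qed.

Lemma fps_deriv_pow a k :
  fps_eq (fps_deriv (fps_pow a k.+1))
    (fps_mul (fps_const k.+1%:R) (fps_mul (fps_pow a k) (fps_deriv a))).
Proof.
elim: k => [|k IHk].
  rewrite /fps_pow /= fps_deriv_mul fps_deriv_one.
  by rewrite -fps_one_const; ring.
rewrite (fps_powS _ k.+1) fps_deriv_mul IHk.
rewrite -[k.+2]addn1 natrD fps_const_add -fps_one_const fps_powS; ring.
Qed.

(** Identities between quotients are checked below by clearing a denominator with nonzero constant
    term. *)
Lemma fps_mulI d a b : d 0%N != 0 ->
  fps_eq (fps_mul a d) (fps_mul b d) -> fps_eq a b.
Proof.
move=> d0 abd; have invd : fps_eq (fps_mul (fps_inv d) d) (fps_one K).
  exact: fps_mulVf.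
transitivity (fps_mul (fps_mul a d) (fps_inv d)).
  transitivity (fps_mul a (fps_mul (fps_inv d) d)); last by ring.
  by rewrite invd; ring.
rewrite abd; transitivity (fps_mul b (fps_mul (fps_inv d) d)); first by ring.
by rewrite invd; ring.
Qed.

Lemma fps_divK a d : d 0%N != 0 -> fps_eq (fps_mul (fps_div a d) d) a.
Proof.
move=> d0; have invd : fps_eq (fps_mul (fps_inv d) d) (fps_one K).
  exact: fps_mulVf.
rewrite /fps_div -fps_mulA invd; ring.
Qed.

(** * Exponential series in characteristic zero *)

Hypothesis pcharK0 : [pchar K] =i pred0.

Lemma natf_neq0_pchar0 n : (n.+1%:R : K) != 0.
Proof. by have /pcharf0P-> := pcharK0. Qed.

Lemma factf_neq0 n : (n`!%:R : K) != 0.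
Proof. by have /pcharf0P-> := pcharK0; rewrite -lt0n fact_gt0. Qed.

Lemma factSf n : (n.+1`!%:R : K) = n.+1%:R * n`!%:R.
Proof. by rewrite factS natrM. Qed.

Lemma fps_deriv_exp z :
  fps_eq (fps_deriv (fps_exp z)) (fps_mul (fps_const z) (fps_exp z)).
Proof.
move=> n; rewrite fps_mul_const /fps_deriv /fps_exp -[_ *+ n.+1]mulr_natr
  factSf invfM.
rewrite -mulrA [X in _ * X]mulrAC mulVf ?natf_neq0_pchar0 // mul1r.
by rewrite exprS -mulrA.
Qed.

Lemma bin_fact_field n i : (i <= n)%N ->
  (i`!%:R)^-1 * ((n - i)`!%:R)^-1 = 'C(n, i)%:R / n`!%:R :> K.
Proof.
move=> le_in; rewrite -(bin_fact le_in) !natrM !invfM.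
rewrite mulrA divff ?mul1r //.
by have /pcharf0P-> := pcharK0; rewrite -lt0n bin_gt0.
Qed.

Lemma fps_mul_exp x y : fps_eq (fps_mul (fps_exp x) (fps_exp y)) (fps_exp (x +
  y)).
Proof.
move=> n; rewrite /fps_exp addrC exprDn mulr_suml; apply: eq_bigr => i _.
rewrite mulrACA bin_fact_field ?leq_ord // mulr_natl mulrnAr mulrnAl.
by rewrite (mulrC (x ^+ i)).
Qed.

Lemma fps_mulX a n : fps_mul (fps_X K) a n.+1 = a n.
Proof.
rewrite /fps_mul big_ord_recl mul0r add0r big_ord_recl mul1r subSS subn0.
by rewrite big1 ?addr0 // => i _; rewrite mul0r.
Qed.

Lemma fps_mul0 a b : fps_mul a b 0%N = a 0%N * b 0%N.
Proof. by rewrite /fps_mul big_ord1. Qed.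

Lemma fps_deriv_X : fps_eq (fps_deriv (fps_X K)) (fps_one K).
Proof. by case=> [|n]; rewrite /fps_deriv /fps_X ?mulr1n //= mul0rn. Qed.

(** * Differential equations for the two series defining the array *)

Variable z : K.

(** The denominator for z = 1, where [L_den] vanishes identically. *)
Definition geom_den : fps K := fps_sub (fps_one K) (fps_X K).

Lemma geom_den0 : geom_den 0%N != 0.
Proof. by rewrite /geom_den /fps_sub /fps_add /fps_opp /fps_X subr0 oner_neq0.
  Qed.

Lemma L_denE : fps_eq (L_den z)
  (fps_sub (fps_exp z) (fps_mul (fps_const z) (fps_exp 1))).
Proof. by move=> n; rewrite /fps_sub /fps_add /fps_opp fps_mul_const. Qed.

Lemma L_den0 : z != 1 -> L_den z 0%N != 0.
Proof.
move=> z1; rewrite /L_den /fps_exp !expr0 divr1 mulr1.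
by rewrite subr_eq0 eq_sym.
Qed.

Definition L_num : fps K := fps_sub (fps_exp 1) (fps_exp z).

Lemma L_f_mul_den : z != 1 -> fps_eq (fps_mul (L_f z) (L_den z)) L_num.
Proof. by move=> z1; rewrite /L_f (negPf z1); apply: fps_divK (L_den0 z1). Qed.

Lemma L_g_mul_den : z != 1 -> fps_eq (fps_mul (L_g z) (L_den z))
  (fps_mul (fps_const (1 - z)) (fps_exp z)).
Proof.
move=> z1; rewrite /L_g (negPf z1) (fps_divK _ (L_den z) (L_den0 z1)) => n.
by rewrite fps_mul_const mulrC.
Qed.

Lemma L_f_mul_geom_den : z = 1 -> fps_eq (fps_mul (L_f z) geom_den) (fps_X K).
Proof. by move=> ->; rewrite /L_f eqxx; apply: fps_divK geom_den0. Qed.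

Lemma L_g_mul_geom_den : z = 1 -> fps_eq (fps_mul (L_g z) geom_den) (fps_one K).
Proof. by move=> ->; rewrite /L_g eqxx; apply: fps_divK geom_den0. Qed.

(** After clearing denominators this is (e^(zx) - z e^x) + z (e^x - e^(zx)) = (1-z) e^(zx), or (1-x)
    + x = 1 when z = 1. *)
Lemma L_gE : fps_eq (L_g z) (fps_add (fps_one K) (fps_mul (fps_const z) (L_f
  z))).
Proof.
case: (eqVneq z 1) => z1.
  refine (@fps_mulI _ _ _ geom_den0 _); rewrite L_g_mul_geom_den // fps_mulDl
    -fps_mulA L_f_mul_geom_den //.
  by rewrite z1 -fps_one_const /geom_den; ring.
refine (@fps_mulI _ _ _ (L_den0 z1) _); rewrite L_g_mul_den // fps_mulDl
  -fps_mulA L_f_mul_den //.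
by rewrite L_denE /L_num fps_const_add fps_const_opp -fps_one_const; ring.
Qed.

Lemma L_f_deriv : fps_eq (fps_deriv (L_f z))
  (fps_mul (fps_add (fps_one K) (L_f z)) (L_g z)).
Proof.
case: (eqVneq z 1) => z1.
  have fD : fps_eq (fps_deriv (fps_mul (L_f z) geom_den)) (fps_one K).
    by rewrite L_f_mul_geom_den // fps_deriv_X.
  have dD : fps_eq (fps_deriv geom_den) (fps_opp (fps_one K)).
    rewrite /geom_den /fps_sub fps_deriv_add fps_deriv_opp fps_deriv_X.
    by rewrite fps_deriv_one; ring.
  refine (@fps_mulI _ _ _ geom_den0 _); rewrite -fps_mulA L_g_mul_geom_den //.
  rewrite -{1}fD fps_deriv_mul dD; ring.
have dD : fps_eq (fps_deriv (L_den z)) (fps_opp (fps_mul (fps_const z) L_num)).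
  rewrite L_denE /fps_sub fps_deriv_add fps_deriv_opp fps_deriv_mul.
  by rewrite !fps_deriv_exp fps_deriv_const -fps_one_const /L_num; ring.
have dN : fps_eq (fps_deriv L_num)
    (fps_sub (fps_exp 1) (fps_mul (fps_const z) (fps_exp z))).
  rewrite /L_num /fps_sub fps_deriv_add fps_deriv_opp.
  by rewrite !fps_deriv_exp -fps_one_const; ring.
refine (@fps_mulI _ _ _ (L_den0 z1) _).
(* With N = [L_num] and D = [L_den z], D' = - z N, so the Leibniz rule gives f' D = (f D)' + z f
   N. *)
transitivity (fps_add (fps_deriv (fps_mul (L_f z) (L_den z)))
   (fps_mul (L_f z) (fps_mul (fps_const z) L_num))).
  by rewrite fps_deriv_mul dD; ring.
rewrite L_f_mul_den // dN -fps_mulA L_g_mul_den // fps_const_add fps_const_opp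
  -fps_one_const.
(* The two sides differ by N - f D, which is zero; adding it explicitly leaves an identity for
   [ring]. *)
set r := fps_mul (fps_add (fps_one K) _) _; transitivity (fps_add r
    (fps_sub L_num (fps_mul (L_f z) (L_den z)))).
  by rewrite L_denE /L_num /r; ring.
by rewrite L_f_mul_den //; ring.
Qed.

Lemma L_f0 : L_f z 0%N = 0.
Proof.
rewrite /L_f; case: eqP => _; rewrite /fps_div fps_mul0 ?mul0r //.
by rewrite /fps_exp !expr0 subrr mul0r.
Qed.

Lemma L_g0 : L_g z 0%N = 1.
Proof.
by rewrite L_gE /fps_add fps_mul_const L_f0 mulr0 addr0.
Qed.

(** The factor 1/k! is left out here and restored in the entries of [L_array]. *)
Definition L_col k : fps K := fps_mul (L_g z) (fps_pow (L_f z) k).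

Lemma L_g_deriv : fps_eq (fps_deriv (L_g z))
  (fps_mul (fps_const z) (fps_mul (fps_add (fps_one K) (L_f z)) (L_g z))).
Proof.
rewrite {1}L_gE fps_deriv_add fps_deriv_mul L_f_deriv.
by rewrite fps_deriv_one fps_deriv_const; ring.
Qed.

Lemma L_col0_deriv : fps_eq (fps_deriv (L_col 0))
  (fps_mul (fps_const z) (fps_add (L_col 0) (L_col 1))).
Proof.
have pow0 : fps_pow (L_f z) 0 = fps_one K by [].
rewrite /L_col fps_powS pow0 fps_deriv_mul L_g_deriv.
by rewrite fps_deriv_one; ring.
Qed.

Lemma L_colS_deriv k : fps_eq (fps_deriv (L_col k.+1))
  (fps_add (fps_mul (fps_const k.+1%:R) (L_col k))
  (fps_add (fps_mul (fps_const (z + (1 + z) * k.+1%:R)) (L_col k.+1))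
           (fps_mul (fps_const (z * k.+2%:R)) (L_col k.+2)))).
Proof.
rewrite /L_col fps_deriv_mul L_g_deriv fps_deriv_pow L_f_deriv !fps_powS.
have -> : fps_eq (fps_const (z + (1 + z) * k.+1%:R)) (fps_add (fps_const z)
    (fps_mul (fps_add (fps_one K) (fps_const z)) (fps_const k.+1%:R))).
  by rewrite fps_const_add fps_const_mul (fps_const_add 1) -fps_one_const.
have -> : fps_eq (fps_const (z * k.+2%:R))
    (fps_mul (fps_const z) (fps_add (fps_const k.+1%:R) (fps_one K))).
  by rewrite -[k.+2]addn1 natrD fps_const_mul fps_const_add -fps_one_const.
set g := L_g z; set f := L_f z; set p := fps_pow f k; set c := fps_const
  k.+1%:R.
(* The factor g coming from f' is traded for 1 + z f, so that only one g remains and the expression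
   expands in powers of f. *)
transitivity (fps_add (fps_mul (fps_mul (fps_const z) (fps_mul (fps_add
  (fps_one K) f) g))
    (fps_mul f p)) (fps_mul c (fps_mul (fps_mul g p)
    (fps_mul (fps_add (fps_one K) f) (fps_add (fps_one K) (fps_mul (fps_const
      z) f)))))).
  by rewrite -L_gE /g /f; ring.
by ring.
Qed.

Lemma L_col_at0 k : L_col k 0%N = (k == 0%N)%:R.
Proof.
rewrite /L_col fps_mul0 L_g0 mul1r; case: k => [|k] //.
by rewrite fps_powS fps_mul0 L_f0 mul0r.
Qed.

(** * The tridiagonal recurrence for the entries *)

Lemma L_array_deriv n k : L_array z n.+1 k = n`!%:R / k`!%:R * fps_deriv (L_col
  k) n.
Proof.
rewrite /L_array /exp_riordan -/(L_col k) /fps_deriv -[_ *+ n.+1]mulr_natl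
  factSf.
by rewrite [RHS]mulrCA !mulrA.
Qed.

Lemma L_array0 k : L_array z 0 k = (k == 0%N)%:R.
Proof.
rewrite /L_array /exp_riordan -/(L_col k) L_col_at0.
by case: k => [|k]; rewrite ?divr1 ?mulr1 // mulr0.
Qed.

Lemma L_arrayS0 n : L_array z n.+1 0 = z * L_array z n 0 + z * L_array z n 1.
Proof.
rewrite L_array_deriv L_col0_deriv fps_mul_const -mulrDr mulrCA; congr (_ * _).
by rewrite /fps_add mulrDr.
Qed.

Lemma L_arraySS n k :
  L_array z n.+1 k.+1 = L_array z n k + (z + (1 + z) * k.+1%:R) * L_array z n
    k.+1
    + (z * k.+2%:R ^+ 2) * L_array z n k.+2.
Proof.
(* Restoring the factorials absorbs the factor k+1 of the lower column and contributes a second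
   factor k+2 to the upper one, whence the square. *)
have kf m : m`!%:R^-1 = m.+1%:R / m.+1`!%:R :> K.
  by rewrite factSf invfM mulrA divff ?mul1r ?natf_neq0_pchar0.
rewrite L_array_deriv L_colS_deriv /fps_add !fps_mul_const.
rewrite [LHS]mulrDr [X in _ + X = _]mulrDr -addrA.
rewrite /L_array /exp_riordan -!/(L_col _); congr (_ + (_ + _)).
- by rewrite mulrA; congr (_ * _); rewrite (kf k) mulrAC mulrA.
- by rewrite mulrCA.
rewrite (kf k.+1) !mulrA; congr (_ * _).
by rewrite -(mulrA _ z) [LHS]mulrC (mulrC n`!%:R) !mulrA.
Qed.

(** * The first column as Eulerian generating function *)

Definition EU_egf : fps K := fun n => EU_at z n / n`!%:R.

(** In positive degree this is [EU_at_rec] multiplied by 1 - z. At z = 1 it is vacuous, so that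
    value is treated separately in [L_g_EU]. *)
Lemma EU_egf_eq : fps_eq EU_egf
  (fps_add (fps_mul (fps_const z) (fps_mul EU_egf (fps_exp (1 - z))))
           (fps_const (1 - z))).
Proof.
case=> [|n]; rewrite /fps_add fps_mul_const /fps_const /=.
  by rewrite fps_mul0 /EU_egf /fps_exp EU_at0 expr0 !divr1 !mulr1 addrC subrK.
rewrite mulr0 addr0 /fps_mul big_ord_recr /= subnn /fps_exp expr0 divr1 mulr1.
rewrite mulrDr -[LHS](subrK (z * EU_egf n.+1)) -{1}[EU_egf _]mul1r -mulrBl.
congr (_ + _); rewrite /EU_egf EU_at_rec -mulrA mulrCA; congr (_ * _).
rewrite mulr_suml mulr_sumr; apply: eq_bigr => i _.
rewrite [RHS]mulrACA bin_fact_field ?(ltnW (ltn_ord i)) // subSn ?leq_ord //.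
rewrite exprS mulr_natl mulrnAl !mulrnAr !mulrA.
by congr (_ / _ *+ _); rewrite mulrC mulrA.
Qed.

(** For z = 1 only the term i = n of the recurrence survives, so EU_n(1) = n! and the series is
    1/(1-x). Otherwise, multiplying [EU_egf_eq] by e^(zx) gives E (e^(zx) - z e^x) = (1-z)
    e^(zx). *)
Lemma L_g_EU : fps_eq (L_g z) EU_egf.
Proof.
case: (eqVneq z 1) => z1.
  have EU1 n : EU_egf n = 1.
    rewrite /EU_egf; suff -> : EU_at z n = n`!%:R by rewrite divff ?factf_neq0.
    elim: n => [|n IHn]; first by rewrite EU_at0.
    have -> : EU_at z n.+1 = \sum_(i < n.+1) (0 ^+ (n - i) * EU_at z i) *+
      'C(n.+1, i).
      by rewrite EU_at_rec {1 2}z1 subrr mul1r.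
    rewrite big_ord_recr /= big1 => [|i _].
      by rewrite add0r subnn mul1r IHn binSn factSf mulr_natl.
    by rewrite expr0n subn_eq0 leqNgt ltn_ord mul0r mul0rn.
  refine (@fps_mulI _ _ _ geom_den0 _); rewrite L_g_mul_geom_den // => n.
  rewrite fps_mulC /geom_den /fps_sub fps_mulDl /fps_add.
  have -> : fps_mul (fps_opp (fps_X K)) EU_egf n = - fps_mul (fps_X K) EU_egf n.
    by rewrite /fps_mul -sumrN; apply: eq_bigr => i _; rewrite mulNr.
  rewrite fps_mul1 EU1; case: n => [|n].
    by rewrite fps_mul0 mul0r subr0.
  by rewrite fps_mulX EU1 subrr.
refine (@fps_mulI _ _ _ (L_den0 z1) _); rewrite L_g_mul_den // L_denE.
have e1 : fps_eq (fps_exp 1) (fps_mul (fps_exp (1 - z)) (fps_exp z)).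
  by rewrite fps_mul_exp subrK.
have e2 : fps_eq (fps_const (1 - z)) (fps_sub EU_egf
    (fps_mul (fps_const z) (fps_mul EU_egf (fps_exp (1 - z))))).
  move=> n; rewrite /fps_sub /fps_opp {1}/fps_add (EU_egf_eq n).
  by rewrite /fps_add addrAC subrr add0r.
by rewrite e1 e2; ring.
Qed.

Lemma L_array_moment n : EU_at z n = L_array z n 0.
Proof.
rewrite /L_array /exp_riordan divr1.
have -> : fps_mul (L_g z) (fps_pow (L_f z) 0) n = EU_egf n.
  by rewrite -L_g_EU fps_mulC fps_mul1.
by rewrite /EU_egf mulrC divfK ?factf_neq0.
Qed.

Theorem EU_are_moments_pchar0 : z != 0 -> EU_are_moments z.
Proof.
move=> z0; pose alpha (k : nat) := z + (1 + z) * k%:R.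
pose beta (k : nat) := z * k%:R ^+ 2.
have [|||| P [invP orthP]] := @tridiagonal_orthogonal K alpha beta (L_array z).
(* Both z != 0 and characteristic zero enter here, to make z k^2 nonzero for k >= 1. *)
- by case=> // n _; rewrite mulf_neq0 ?expf_neq0 ?natf_neq0_pchar0.
- exact: L_array0.
- by move=> n; rewrite L_arrayS0 /alpha /beta mulr0 addr0 expr1n mulr1.
- exact: L_arraySS.
exists P; split=> //; exists (L_array z); first exact: is_inverse_sym.
exact: L_array_moment.
Qed.

End PowerSeriesRing.

(** Allows z to be an indeterminate, as the nonzero element ['X] of the field of rational
    functions. *)
Lemma pchar0_frac_poly (K : fieldType) :
  [pchar K] =i pred0 -> [pchar {fraction {poly K}}] =i pred0.
Proof.
move=> /pcharf0P K0; apply/pcharf0P => n.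
by rewrite -(rmorph_nat (@tofrac {poly K})) tofrac_eq0 -polyC_natr polyC_eq0 K0.
Qed.

Theorem theorem2 (K : fieldType) (charK0 : [pchar K] =i pred0) :
  EU_are_moments (tofrac ('X : {poly K})) /\
  (forall z : K, z != 0 -> EU_are_moments z).
Proof.
split=> [|z]; last exact: EU_are_moments_pchar0.
apply: EU_are_moments_pchar0; first exact: pchar0_frac_poly.
by rewrite tofrac_eq0 polyX_eq0.
Qed.
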